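(* Suppose Assumptions 1–6 hold. Then $$R_n(\mathbf w_n^* )-R_n(\tilde{\mathbf w}_n^* )=o\{R_n(\mathbf w_n^* )\},$$ i.e. the optimal model averaging risks over $\mathcal W_n$ and over $\mathcal Q_n$ are asymptotically equivalent. No assumption on $M_n$ or on the decay of $\theta_{n,m}$ is needed.
   Context: Setting. For each sample size $n$ one observes $\mathbf y=\boldsymbol\mu+\boldsymbol\varepsilon\in\mathbb R^n$ with $\boldsymbol\mu=\mathbf X\boldsymbol\beta$, where $\mathbf X=(x_{ij})$ is a nonstochastic $n\times p_n$ matrix with $p_n<n$, $E(\boldsymbol\varepsilon)=\mathbf 0$, $\mathrm{Cov}(\boldsymbol\varepsilon)=\boldsymbol\Omega$ positive definite (all may depend on $n$). Fix integers $0=\nu_0<\nu_1<\cdots<\nu_{q_n}=p_n$. For $m=1,\dots,q_n$, $\mathbf X_m$ is the $n\times\nu_m$ matrix of the first $\nu_m$ columns of $\mathbf X$ (full column rank), $\mathbf P_m=\mathbf X_m(\mathbf X_m^\top\mathbf X_m)^{-1}\mathbf X_m^\top$, $\mathbf P_0=\mathbf 0$. Candidate models are $m\in\{1,\dots,M_n\}$, $2\le M_n\le q_n$. $R_n(m)=E\|\mathbf P_m\mathbf y-\boldsymbol\mu\|^2$; for $\mathbf w\in\mathbb R^{M_n}$, $R_n(\mathbf w)=E\|\sum_{m=1}^{M_n}w_m\mathbf P_m\mathbf y-\boldsymbol\mu\|^2$. $\mathcal W_n=\{\mathbf w\in[0,1]^{M_n}:\sum_m w_m=1\}$ and $\mathcal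 Q_n=[0,1]^{M_n}$. $\mathbf w_n^*$ minimizes $R_n(\mathbf w)$ over $\mathcal W_n$ and $\tilde{\mathbf w}_n^*$ minimizes it over $\mathcal Q_n$; $m_n^{**}$ minimizes $R_n(m)$ over $\{1,\dots,q_n\}$ (all unique). $\theta_{n,m}=\dfrac{n^{-1}\boldsymbol\mu^\top(\mathbf P_m-\mathbf P_{m-1})\boldsymbol\mu}{\mathrm{tr}\{(\mathbf P_m-\mathbf P_{m-1})\boldsymbol\Omega\}}$, $m=1,\dots,q_n$; $d_n=\max\{m:\theta_{n,m}>0\}$. Assumption 1: $\|\boldsymbol\mu\|^2/n=O(1)$. Assumption 2: constants $0<c_1\le c_2<\infty$ with $c_1<\lambda_{\min}(\boldsymbol\Omega)\le\lambda_{\max}(\boldsymbol\Omega)<c_2$. Assumption 3: for each large $n$, $\theta_{n,1}\ge\cdots\ge\theta_{n,q_n}$. Assumption 4: a constant $V\ge1$ with $\max_{1\le m\le d_n}(\nu_m-\nu_{m-1})\le V$ for all large $n$. Assumption 5: for every fixed positive integer $m$ there are $\bar\theta_m>0$, $K_m>0$ such that for all $n\ge K_m$, $m\le d_n$ and $\theta_{n,m}\ge\bar\theta_m$. Assumption 6: for each large $n$ there is $m_n'\in\{1,\dots,d_n-1\}$ with $R_n(m)<R_n(m-1)$ for $2\le m\le m_n'$, $R_n(m)\ge R_n(m-1)$ for $m_n'<m\le d_n$, and $R_n(d_n)>R_n(d_n-1)$. *)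

(* Defs.v *)
From HB Require Import structures.
From mathcomp Require Import all_boot all_order all_algebra.
From mathcomp Require Import all_classical all_reals all_analysis.
Set Implicit Arguments. Unset Strict Implicit. Unset Printing Implicit Defensive.
Import Order.TTheory GRing.Theory Num.Theory.
Local Open Scope ring_scope.

Section Defs.
Variable R : realType.

(* the n x k matrix of the first k columns of X (entries beyond column p are 0;
   only used with k <= p) *)
Definition firstcols (n p : nat) (X : 'M[R]_(n, p)) (k : nat) : 'M[R]_(n, k) :=
  \matrix_(i < n, j < k)
    (if (insub (val j) : option 'I_p) is Some j' then X i j' else 0).

Definition projmat (n p : nat) (X : 'M[R]_(n, p)) (k : nat) : 'M[R]_n :=
  let Xk := firstcols X k in Xk *m invmx (Xk^T *m Xk) *m Xk^T.

Definition sqnorm (n : nat) (v : 'cV[R]_n) : R := \sum_(i < n) (v i 0) ^+ 2.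

Definition risk (d : measure_display) (T : measurableType d) (P : probability T R)
  (n : nat) (eps : T -> 'cV[R]_n) (mu : 'cV[R]_n) (A : 'M[R]_n) : R :=
  fine ('E_P[fun t => sqnorm (A *m (mu + eps t) - mu)])%E.

(* sum_{m=1}^{M} w_m P_m ; coordinate i : 'I_M of w is model m = i+1 *)
Definition avgmat (n M : nat) (Pm : nat -> 'M[R]_n) (w : 'rV[R]_M) : 'M[R]_n :=
  \sum_(i < M) w 0 i *: Pm i.+1.

Definition inW (M : nat) (w : 'rV[R]_M) : Prop :=
  (forall i, 0 <= w 0 i <= 1) /\ \sum_(i < M) w 0 i = 1.

Definition inQ (M : nat) (w : 'rV[R]_M) : Prop := forall i, 0 <= w 0 i <= 1.

Definition posdef (n : nat) (A : 'M[R]_n) : Prop :=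
  A^T = A /\ forall v : 'cV[R]_n, v != 0 -> 0 < (v^T *m A *m v) 0 0.

Definition theta (n : nat) (Pm : nat -> 'M[R]_n) (mu : 'cV[R]_n) (Om : 'M[R]_n)
  (m : nat) : R :=
  let D := Pm m - Pm m.-1 in
  (n%:R^-1 * (mu^T *m D *m mu) 0 0) / \tr (D *m Om).

(* d_n = max { m in 1..q : theta_{n,m} > 0 }  (0 if the set is empty) *)
Definition dn (n q : nat) (Pm : nat -> 'M[R]_n) (mu : 'cV[R]_n) (Om : 'M[R]_n) : nat :=
  (\max_(m < q.+1 | (0 < m)%N && (0 < theta Pm mu Om m)%R) m)%N.

End Defs.

(* Main.v *)
(* With g_j the sum of the w_i over i >= j and D_j = P_j - P_(j-1), the risk
   separates:  R(w) = |mu|^2 + sum_j ((g_j^2 - 2 g_j) b_j + g_j^2 v_j),  where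
   v_j = tr(D_j Om) and b_j = mu^T D_j mu = n theta_j v_j.  Each term is smallest
   at g_j = n theta_j / (1 + n theta_j), and on the simplex the only additional
   constraints are g_1 = 1 and monotonicity.  As theta is nonincreasing, the
   choice g_1 = 1 and g_j optimal for j >= 2 is realised in the simplex, and it
   loses at most v_1 / (1 + n theta_1) against any weight vector.  Since g_1 = 1
   forces R(w) >= v_1 on the simplex, the relative loss is at most
   1 / (1 + n theta_1), which tends to 0 because theta_1 is bounded below. *)
Require Import Defs.
From HB Require Import structures.
From mathcomp Require Import all_boot all_order all_algebra.
From mathcomp Require Import all_classical all_reals all_analysis.
From mathcomp Require Import measurable_realfun ring lra.
Import Order.TTheory GRing.Theory Num.Theory.
Local Open Scope classical_set_scope.
Local Open Scope ring_scope.
Set Implicit Arguments.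
Unset Strict Implicit.
Unset Printing Implicit Defensive.

(** * Squared norms and Gram matrices *)

Lemma sqnormE (R : realType) (n : nat) (v : 'cV[R]_n) :
  sqnorm v = (v^T *m v) 0 0.
Proof. by rewrite mxE; apply: eq_bigr => i _; rewrite mxE expr2. Qed.

Lemma sqnormD (R : realType) (n : nat) (u v : 'cV[R]_n) :
  sqnorm (u + v) = sqnorm u + (2 * (u^T *m v) 0 0 + sqnorm v).
Proof.
rewrite /sqnorm mxE mulr_sumr -!big_split /=.
by apply: eq_bigr => i _; rewrite !mxE; ring.
Qed.

Lemma sqnorm_ge0 (R : realType) (n : nat) (v : 'cV[R]_n) : 0 <= sqnorm v.
Proof. by apply: sumr_ge0 => i _; exact: sqr_ge0. Qed.

Lemma sqnorm_eq0 (R : realType) (n : nat) (v : 'cV[R]_n) :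
  (sqnorm v == 0) = (v == 0).
Proof.
apply/eqP/eqP => [v0|->]; last by rewrite sqnormE mulmx0 mxE.
apply/matrixP => i j; rewrite ord1 mxE; apply/eqP; rewrite -sqrf_eq0.
by move: v0 => /psumr_eq0P -> // k _; exact: sqr_ge0.
Qed.

(** A row vector [v] killed by the Gram matrix makes the squared norm of [A *m v^T] zero, and full
    column rank then forces [v] to vanish. *)
Lemma gram_unitmx (R : realType) (n k : nat) (A : 'M[R]_(n, k)) :
  \rank A = k -> A^T *m A \in unitmx.
Proof.
move=> rkA; rewrite -row_free_unit -kermx_eq0; apply/rowV0P => v /sub_kermxP vG0.
have : sqnorm (A *m v^T) == 0.
  by rewrite sqnormE trmx_mul trmxK mulmxA -(mulmxA v) vG0 mul0mx mxE.
rewrite sqnorm_eq0 => /eqP /(congr1 trmx); rewrite trmx_mul trmxK trmx0 => /eqP.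
rewrite mulmx_free_eq0; first by move/eqP.
by rewrite /row_free mxrank_tr rkA.
Qed.

(** * Nested orthogonal projections *)

Section Projmat.
Variables (R : realType) (n p : nat) (X : 'M[R]_(n, p)).

Lemma projmat0 : projmat X 0 = 0.
Proof. by rewrite /projmat [firstcols X 0]thinmx0 !mul0mx. Qed.

Lemma tr_projmat k : (projmat X k)^T = projmat X k.
Proof. by rewrite /projmat !trmx_mul trmxK trmx_inv trmx_mul trmxK mulmxA. Qed.

Lemma firstcols_le k l : (k <= l)%N ->
  firstcols X k = firstcols X l *m (\matrix_(i < l, j < k) (val i == val j)%:R).
Proof.
move=> kl; apply/matrixP => i j; rewrite [RHS]mxE.
rewrite (bigD1 (widen_ord kl j)) //= !mxE eqxx mulr1 big1 ?addr0// => h hj.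
by rewrite !mxE (_ : (_ == _) = false) ?mulr0//; apply: contraNF hj.
Qed.

Lemma projmatM_firstcols k : \rank (firstcols X k) = k ->
  projmat X k *m firstcols X k = firstcols X k.
Proof. by move=> rk; rewrite /projmat -!mulmxA mulVmx ?gram_unitmx// mulmx1. Qed.

Lemma projmatM_le k l : (k <= l)%N -> \rank (firstcols X l) = l ->
  projmat X l *m projmat X k = projmat X k.
Proof.
move=> kl rl; rewrite {2 3}/projmat !mulmxA; do 2 congr (_ *m _).
by rewrite (firstcols_le kl) mulmxA projmatM_firstcols.
Qed.

Lemma projmatM k l : \rank (firstcols X k) = k -> \rank (firstcols X l) = l ->
  projmat X k *m projmat X l = projmat X (minn k l).
Proof.
move=> rk rl; have [kl|/ltnW lk] := leqP k l; last exact: projmatM_le.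
by apply: trmx_inj; rewrite trmx_mul !tr_projmat projmatM_le.
Qed.
End Projmat.

(** * Combinations of mutually orthogonal projections *)

Section OrthogonalFamily.
Variables (R : realType) (n M : nat) (D : 'I_M -> 'M[R]_n).
Hypothesis trD : forall i, (D i)^T = D i.
Hypothesis mulD : forall i j, D i *m D j = if i == j then D i else 0.

Lemma tr_orthosum (g : 'I_M -> R) :
  (\sum_i g i *: D i)^T = \sum_i g i *: D i.
Proof. by rewrite linear_sum; apply: eq_bigr => i _; rewrite linearZ /= trD. Qed.

Lemma orthosum_sqr (g : 'I_M -> R) :
  (\sum_i g i *: D i) *m (\sum_i g i *: D i) = \sum_i g i ^+ 2 *: D i.
Proof.
rewrite mulmx_suml; apply: eq_bigr => i _.
rewrite mulmx_sumr (bigD1 i)//= big1 ?addr0 => [|j ji].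
  by rewrite -scalemxAl -scalemxAr mulD eqxx scalerA expr2.
by rewrite -scalemxAl -scalemxAr mulD eq_sym (negPf ji) !scaler0.
Qed.

(** The combination is symmetric and its square only squares the coefficients, so expanding the norm
    leaves no cross terms. *)
Lemma sqnorm_orthosum (g : 'I_M -> R) (u : 'cV[R]_n) :
  sqnorm ((\sum_i g i *: D i) *m u - u) =
  sqnorm u + \sum_i (g i ^+ 2 - 2 * g i) * (u^T *m D i *m u) 0 0.
Proof.
set A := \sum_i _.
have quadE (h : 'I_M -> R) : (u^T *m (\sum_i h i *: D i) *m u) 0 0 =
    \sum_i h i * (u^T *m D i *m u) 0 0.
  rewrite mulmx_sumr mulmx_suml summxE; apply: eq_bigr => i _.
  by rewrite -scalemxAr -scalemxAl mxE.
have -> : sqnorm (A *m u - u) =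
    sqnorm u + ((u^T *m (A *m A) *m u) 0 0 - 2 * (u^T *m A *m u) 0 0).
  rewrite !sqnormE [(_ - _)^T]linearB /= trmx_mul tr_orthosum -/A.
  have entB (C E : 'M[R]_1) : (C - E) 0 0 = C 0 0 - E 0 0 by rewrite !mxE.
  rewrite mulmxBl !mulmxBr !entB !mulmxA; ring.
rewrite /A orthosum_sqr !quadE; congr (_ + _).
rewrite mulr_sumr -sumrB; apply: eq_bigr => i _; ring.
Qed.

Lemma mxtrace_orthosum (g : 'I_M -> R) (S : 'M[R]_n) :
  \tr ((\sum_i g i *: D i) *m S *m (\sum_i g i *: D i)^T) =
  \sum_i g i ^+ 2 * \tr (D i *m S).
Proof.
rewrite mxtrace_mulC mulmxA tr_orthosum orthosum_sqr mulmx_suml raddf_sum /=.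
by apply: eq_bigr => i _; rewrite -scalemxAl mxtraceZ.
Qed.
End OrthogonalFamily.

(** * Bias-variance decomposition of the risk *)

Section Risk.
Variables (R : realType) (d : measure_display) (T : measurableType d).
Variables (P : probability T R).

(** Integrability is carried through the induction together with the value, since additivity of the
    integral requires it at each step. *)
Let integral_lincomb (I : finType) (a : I -> R) (f : I -> T -> R) :
  (forall i, P.-integrable setT (EFin \o f i)) ->
  P.-integrable setT (EFin \o (fun t => \sum_i a i * f i t)) /\
  (\int[P]_t (\sum_i a i * f i t) = \sum_i a i * \int[P]_t f i t)%R.
Proof.
move=> fi; elim: (index_enum I) => [|i s [IHi IHE]].
  split.
    under [X in _.-integrable _ X]eq_fun do rewrite /= big_nil.
    exact: (finite_measure_integrable_cst P 0).
  under eq_Rintegral do rewrite big_nil.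
  by rewrite big_nil Rintegral_cst// mul0r.
have afi : P.-integrable setT (EFin \o (fun t => a i * f i t)).
  exact: (integrableZl measurableT (a i) (fi i)).
split.
  under [X in _.-integrable _ X]eq_fun do rewrite /= big_cons EFinD.
  exact: integrableD.
under eq_Rintegral do rewrite big_cons.
by rewrite RintegralD// RintegralZl// big_cons IHE.
Qed.

Variables (n : nat) (eps : T -> 'cV[R]_n) (Om : 'M[R]_n).
Hypothesis meps : forall i, measurable_fun setT (fun t => eps t i ord0).
Hypothesis ieps2 : forall i, P.-integrable setT (fun t => ((eps t i ord0) ^+ 2)%:E).

Let integrable_prod i j :
  P.-integrable setT (EFin \o (fun t => eps t i ord0 * eps t j ord0)).
Proof.
apply: (le_integrable measurableT _ _ (integrableD measurableT (ieps2 i) (ieps2 j))).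
  by apply/measurable_EFinP; apply: measurable_funM; exact: meps.
move=> t _; rewrite -EFinD !abse_EFin lee_fin.
set x := eps t i ord0; set y := eps t j ord0.
rewrite [leRHS]ger0_norm ?addr_ge0 ?sqr_ge0// ler_norml.
(* These two squares bound [|x * y|] by half of [x^2 + y^2]. *)
have := sqr_ge0 (x + y); have := sqr_ge0 (x - y).
have := sqr_ge0 x; have := sqr_ge0 y; nra.
Qed.

Let integrable_eps i : P.-integrable setT (EFin \o (fun t => eps t i ord0)).
Proof.
have i1 := finite_measure_integrable_cst P (1 : R) measurableT.
apply: (le_integrable measurableT _ _ (integrableD measurableT i1 (ieps2 i))).
  by apply/measurable_EFinP; exact: meps.
move=> t _; rewrite [X in (_ <= `|X|)%E](_ : _ = (1 + eps t i ord0 ^+ 2)%:E)//.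
rewrite !abse_EFin lee_fin.
set x := eps t i ord0.
rewrite [leRHS]ger0_norm ?addr_ge0 ?sqr_ge0 ?ler01// ler_norml.
have := sqr_ge0 (x + 1); have := sqr_ge0 (x - 1).
have := sqr_ge0 x; nra.
Qed.

Hypothesis Eeps : forall i, ('E_P[fun t => eps t i ord0] = 0%:E)%E.
Hypothesis Ceps : forall i j,
  ('E_P[fun t => (eps t i ord0 * eps t j ord0)%R] = (Om i j)%:E)%E.

Lemma riskE (mu : 'cV[R]_n) (A : 'M[R]_n) :
  risk P eps mu A = sqnorm (A *m mu - mu) + \tr (A *m Om *m A^T).
Proof.
set c := A *m mu - mu; pose B := A^T *m A.
have trB : B^T = B by rewrite trmx_mul trmxK.
(* The loss is constant plus linear plus quadratic in the noise: the linear part has mean zero, and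
   the quadratic part averages to the trace. The index order in [B k.2 k.1] is the one in which the
   trace of [B *m Om] expands. *)
have loss t : sqnorm (A *m (mu + eps t) - mu) =
    sqnorm c + (\sum_j (2 * (c^T *m A) 0 j) * eps t j ord0 +
    \sum_(k : 'I_n * 'I_n) B k.2 k.1 * (eps t k.1 ord0 * eps t k.2 ord0)).
  have -> : A *m (mu + eps t) - mu = c + A *m eps t by rewrite mulmxDr addrAC.
  rewrite sqnormD [sqnorm (A *m _)]sqnormE trmx_mul !mulmxA -(mulmxA _ A^T) -/B.
  congr (_ + (_ + _)); first by rewrite mxE mulr_sumr; apply: eq_bigr => j _; ring.
  rewrite -(pair_bigA _ (fun k j => B j k * (eps t k ord0 * eps t j ord0)))/=.
  rewrite exchange_big mxE; apply: eq_bigr => j _; rewrite mxE mulr_suml.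
  apply: eq_bigr => k _; rewrite [(eps t)^T _ _]mxE.
  have -> : B k j = B j k by rewrite -[in LHS]trB mxE.
  ring.
have [li lE] := integral_lincomb (fun j => 2 * (c^T *m A) 0 j) integrable_eps.
have [qi qE] := integral_lincomb (fun k : 'I_n * 'I_n => B k.2 k.1)
  (fun k => integrable_prod k.1 k.2).
have cstE (k : R) : (\int[P]_t k)%R = k.
  rewrite Rintegral_cst//= -[RHS]mulr1; congr (_ * _).
  exact: (congr1 fine (probability_setT P)).
rewrite /risk unlock -/(Rintegral P setT _).
under eq_Rintegral do rewrite loss.
rewrite RintegralD//; last 2 first.
- exact: finite_measure_integrable_cst.
- under [X in _.-integrable _ X]eq_fun do rewrite /= EFinD; exact: integrableD.
rewrite RintegralD// cstE lE qE big1 ?add0r => [|j _].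
  congr (_ + _); rewrite mxtrace_mulC mulmxA -/B /mxtrace.
  under [RHS]eq_bigr do rewrite mxE.
  rewrite exchange_big pair_big /=; apply: eq_bigr => -[k j] _ /=.
  by have := Ceps k j; rewrite unlock /Rintegral => ->.
by have := Eeps j; rewrite unlock /Rintegral => -> /=; rewrite mulr0.
Qed.
End Risk.

(** * Tail sums of the weights *)

Section CumulativeWeights.
Variables (R : realType) (M : nat).

(** Coordinate [i] stands for model [i+1], so [cumw w j] is the tail sum g_(j+1) of the overview. *)
Definition cumw (w : 'rV[R]_M) (j : nat) : R := \sum_(i < M | (j <= i)%N) w 0 i.

(** Summation by parts: each projection telescopes into increments starting from zero, and
    exchanging the sums gathers the weights on each increment. *)
Lemma avgmatE (n : nat) (Pm : nat -> 'M[R]_n) (w : 'rV[R]_M) : Pm 0%N = 0 ->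
  avgmat Pm w = \sum_(j < M) cumw w j *: (Pm j.+1 - Pm j).
Proof.
move=> P0; under [RHS]eq_bigr do rewrite scaler_suml.
rewrite (exchange_big_dep xpredT)//=; apply: eq_bigr => i _.
rewrite -scaler_sumr; congr (_ *: _).
rewrite -[LHS]subr0 -[X in _ - X]P0 -(telescope_sumr Pm (leq0n i.+1)) big_mkord.
rewrite (big_ord_widen M (fun k => Pm k.+1 - Pm k) (ltn_ord i)).
by apply: eq_bigl => j; rewrite ltnS.
Qed.

Lemma cumw0 (w : 'rV[R]_M) : inW w -> cumw w 0 = 1.
Proof. by case=> _ <-. Qed.

(** This turns prescribed tail sums into weights; the differences telescope, with nothing left at
    the end [M]. *)
Lemma cumw_differences (g : nat -> R) : g M = 0 ->
  forall j, (j <= M)%N -> cumw (\row_(i < M) (g i - g i.+1)) j = g j.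
Proof.
move=> gM j jM; rewrite /cumw; under eq_bigr do rewrite mxE.
rewrite -(big_mkord (leq j) (fun i => g i - g i.+1)) (big_cat_nat (leq0n j) jM)//=.
rewrite big_nat_cond big_pred0 ?add0r => [|i]; last first.
  by rewrite /= andbC; case: leqP => //; rewrite ltnNge => ->.
rewrite big_nat_cond (eq_bigl (fun i => j <= i < M)%N) => [|i]; last first.
  by case: (j <= i)%N; rewrite ?andbT ?andbF.
rewrite -big_nat -[RHS]subr0 -[X in _ = _ - X]gM -[RHS]opprB -telescope_sumr// -sumrN.
by apply: eq_bigr => i _; rewrite opprB.
Qed.

Lemma inW_differences (g : nat -> R) : g 0%N = 1 -> g M = 0 ->
  (forall j, (j < M)%N -> g j.+1 <= g j) ->
  inW (\row_(i < M) (g i - g i.+1)).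
Proof.
move=> g0 gM gd.
set w := \row_i _; have sum_w : \sum_i w 0 i = 1.
  by rewrite -g0 -(cumw_differences gM (leq0n _)).
have w_ge0 i : 0 <= w 0 i by rewrite mxE subr_ge0 gd.
split=> // i; rewrite w_ge0 -sum_w (bigD1 i)//= lerDl.
by apply: sumr_ge0 => k _.
Qed.
End CumulativeWeights.

(** * Variance of an increment and optimal shrinkage *)

Lemma mxtrace_orthoproj (R : realType) (n : nat) (D S : 'M[R]_n) :
  posdef S -> D^T = D -> D *m D = D ->
  0 <= \tr (D *m S) /\ (\tr (D *m S) = 0 -> D = 0).
Proof.
move=> [_ Spos] trD DD.
have quadE i : (D *m S *m D^T) i i =
    ((row i D)^T^T *m S *m (row i D)^T) 0 0.
  by rewrite trmxK -!row_mul tr_row !mxE; apply: eq_bigr => k _; rewrite !mxE.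
have quad_ge0 i : 0 <= (D *m S *m D^T) i i.
  rewrite quadE; have [->|/Spos/ltW//] := eqVneq (row i D)^T 0.
  by rewrite mulmx0 mxE.
(* As [D] is a symmetric idempotent, the trace is a sum of values of the form [S] at the rows of
   [D]; if it vanishes, so does every row. *)
have -> : \tr (D *m S) = \sum_i (D *m S *m D^T) i i.
  by rewrite -[RHS]/(\tr _) [RHS]mxtrace_mulC mulmxA trD DD.
split=> [|/psumr_eq0P D0]; first by apply: sumr_ge0 => i _.
apply/row_matrixP => i; rewrite row0; apply: trmx_inj; rewrite trmx0.
apply: contra_eq (D0 (fun i _ => quad_ge0 i) i isT) => /Spos.
by rewrite quadE; apply: lt0r_neq0.
Qed.

(** Completing the square: the two sides differ by [v * (1 + t) * (g - s)^2]. *)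
Lemma shrinkage_min (R : realType) (t v g s : R) : 0 <= t -> 0 <= v ->
  s = t / (1 + t) ->
  (s ^+ 2 - 2 * s) * (t * v) + s ^+ 2 * v <=
  (g ^+ 2 - 2 * g) * (t * v) + g ^+ 2 * v.
Proof.
move=> t0 v0 ->; rewrite -subr_ge0.
have t1 : 1 + t != 0 by rewrite gt_eqF// ltr_pwDl.
rewrite [leRHS](_ : _ = v * (1 + t) * (g - t / (1 + t)) ^+ 2); last by field.
by rewrite mulr_ge0 ?sqr_ge0// mulr_ge0// addr_ge0.
Qed.

(** * Risk of nested averages and the gap on the simplex *)

Section Increments.
Variables (R : realType) (n q : nat) (Pm : nat -> 'M[R]_n).
Hypothesis trP : forall k, (Pm k)^T = Pm k.
Hypothesis mulP : forall k l, (k <= q)%N -> (l <= q)%N ->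
  Pm k *m Pm l = Pm (minn k l).

Lemma tr_increment i : (Pm i.+1 - Pm i)^T = Pm i.+1 - Pm i.
Proof. by rewrite linearB /= !trP. Qed.

Lemma incrementM i j : (i < q)%N -> (j < q)%N ->
  (Pm i.+1 - Pm i) *m (Pm j.+1 - Pm j) = if i == j then Pm i.+1 - Pm i else 0.
Proof.
move=> iq jq; rewrite mulmxBl !mulmxBr !mulP ?(ltnW iq) ?(ltnW jq)//.
have [ij|ji|<-] := ltngtP i j.
- by rewrite !(minn_idPl _) ?subrr// ?leqW// ltnW.
- by rewrite !(minn_idPr _) ?subrr// ?leqW// ltnW.
- by rewrite !minnn (minn_idPr (leqnSn i)) (minn_idPl (leqnSn i)) subrr subr0.
Qed.

Variables (mu : 'cV[R]_n) (Om : 'M[R]_n) (M : nat).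
Hypothesis P0 : Pm 0%N = 0.
Hypothesis Mq : (M <= q)%N.

Let rk (A : 'M[R]_n) : R := sqnorm (A *m mu - mu) + \tr (A *m Om *m A^T).
Let b i := (mu^T *m (Pm i.+1 - Pm i) *m mu) 0 0.
Let v i := \tr ((Pm i.+1 - Pm i) *m Om).
Let t i := n%:R * theta Pm mu Om i.+1.

Lemma nested_riskE (w : 'rV[R]_M) :
  rk (avgmat Pm w) = sqnorm mu +
    \sum_(i < M) ((cumw w i ^+ 2 - 2 * cumw w i) * b i + cumw w i ^+ 2 * v i).
Proof.
have trD (i : 'I_M) := tr_increment i.
have mulD (i j : 'I_M) :=
  incrementM (leq_trans (ltn_ord i) Mq) (leq_trans (ltn_ord j) Mq).
rewrite avgmatE// /rk sqnorm_orthosum// mxtrace_orthosum//.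
by rewrite big_split addrA.
Qed.

Hypothesis posOm : posdef Om.

Let v_ge0 i : (i < q)%N -> 0 <= v i /\ (v i = 0 -> b i = 0).
Proof.
move=> iq; have DD := incrementM iq iq; rewrite eqxx in DD.
have [v0 vD] := mxtrace_orthoproj posOm (tr_increment i) DD.
by split=> // /vD D0; rewrite /b D0 mulmx0 mul0mx mxE.
Qed.

(** If [v i = 0], the quotient in [theta] is a division by zero, but the increment itself is then
    zero, so [b i] vanishes too. *)
Let bE i : (0 < n)%N -> (i < q)%N -> b i = t i * v i.
Proof.
move=> n0 iq; have [_ vb] := v_ge0 iq.
rewrite /t /theta -/(b i) -/(v i).
have [v0|v0] := eqVneq (v i) 0; first by rewrite v0 mulr0 vb.
by field; rewrite v0 pnatr_eq0 -lt0n.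
Qed.

Let b_ge0 i : (i < q)%N -> 0 <= b i.
Proof.
move=> iq; have DD := incrementM iq iq; rewrite eqxx in DD.
by rewrite /b -DD mulmxA -{1}tr_increment -trmx_mul -mulmxA -sqnormE sqnorm_ge0.
Qed.

(** The competitor [w] ranges over all vectors, because each summand of its risk is compared with
    the unconstrained minimum of that summand. *)
Lemma simplex_risk_gap (ws w : 'rV[R]_M) : (0 < n)%N -> (0 < M)%N ->
  (forall m, (1 <= m)%N -> (m < q)%N -> theta Pm mu Om m.+1 <= theta Pm mu Om m) ->
  inW ws -> (forall w' : 'rV[R]_M, inW w' -> rk (avgmat Pm ws) <= rk (avgmat Pm w')) ->
  [/\ 0 <= v 0, v 0 <= rk (avgmat Pm ws) &
     rk (avgmat Pm ws) - rk (avgmat Pm w) <= v 0 / (1 + n%:R * theta Pm mu Om 1)].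
Proof.
move=> n0 M0 th_dec wsW ws_min.
have ltq i : (i < M)%N -> (i < q)%N by move=> iM; exact: leq_trans Mq.
have t_ge0 i : (i < M)%N -> 0 <= t i.
  move=> /ltq iq; have [v0 _] := v_ge0 iq.
  by rewrite /t /theta mulr_ge0// divr_ge0// mulr_ge0 ?invr_ge0 ?b_ge0.
have t1_gt0 i : (i < M)%N -> 0 < 1 + t i by move=> /t_ge0; exact: ltr_pwDl.
have [v0_ge0 _] := v_ge0 (ltq _ M0).
split=> //.
  (* Lower bound: drop the bias and every variance term but the first, whose coefficient is 1 on the
     simplex. *)
  rewrite /rk avgmatE// mxtrace_orthosum; last 2 first.
  - by move=> i; exact: tr_increment.
  - by move=> i j; apply: incrementM; exact: ltq.
  rewrite ler_wpDl ?sqnorm_ge0// (bigD1 (Ordinal M0))//= cumw0// expr1n mul1r lerDl.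
  apply: sumr_ge0 => i _; rewrite mulr_ge0 ?sqr_ge0//.
  by have [] := v_ge0 (ltq _ (ltn_ord i)).
(* Target tail sums: 1 at the start as the simplex demands, optimal shrinkage afterwards, 0 at [M]
   to close the telescope. *)
pose g i : R := if i == 0%N then 1 else if (i < M)%N then t i / (1 + t i) else 0.
have g_dec j : (j < M)%N -> g j.+1 <= g j.
  move=> jM; rewrite /g /= jM; case: ltnP => [j1M|_]; last first.
    by case: eqP => // _; rewrite divr_ge0 ?t_ge0// ltW ?t1_gt0.
  case: eqP => [_|/eqP j0].
    by rewrite ler_pdivrMr ?t1_gt0// mul1r lerDr.
  (* Since [x / (1 + x)] is increasing, monotonicity passes from [theta] to [g]. *)
  rewrite ler_pdivrMr ?t1_gt0// mulrAC ler_pdivlMr ?t1_gt0//.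
  have : t j.+1 <= t j by rewrite ler_wpM2l// th_dec ?ltq.
  by move=> ?; rewrite !mulrDr !mulr1 [t j * _]mulrC lerD2r.
have gM : g M = 0 by rewrite /g ltnn gtn_eqF.
have wgW := @inW_differences R M g erefl gM g_dec.
apply: le_trans (lerB (ws_min _ wgW) (lexx _)) _.
rewrite !nested_riskE opprD addrACA subrr add0r -sumrB (bigD1 (Ordinal M0))//=.
(* Every summand after the first is already minimal for [g], so the first one bears the whole
   gap. *)
rewrite -[leRHS]addr0; apply: lerD; last first.
  apply: sumr_le0 => i i0; rewrite subr_le0 cumw_differences 1?ltnW//.
  rewrite !bE ?ltq//; apply: shrinkage_min; rewrite ?t_ge0//.
    by have [] := v_ge0 (ltq _ (ltn_ord i)).
  have /negPf i0' : (i : nat) != 0%N by apply: contraNneq i0 => i0; exact/eqP/val_inj.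
  by rewrite /g i0' ltn_ord.
rewrite cumw_differences// bE ?ltq// -/(t 0).
have := shrinkage_min (cumw w 0) (t_ge0 _ M0) v0_ge0 erefl.
have t1_neq0 : 1 + t 0 != 0 by rewrite gt_eqF// t1_gt0.
(* The first summand equals [v 0 - t 0 * v 0] at tail sum 1; its minimum lies below that by exactly
   [v 0 / (1 + t 0)]. *)
rewrite [leLHS](_ : _ = v 0 - t 0 * v 0 - v 0 / (1 + t 0)); last by field.
rewrite /g /=; lra.
Qed.
End Increments.

(** * Asymptotic equivalence *)

Theorem theorem5 (R : realType) (d : measure_display)
  (T : nat -> measurableType d) (P : forall n : nat, probability (T n) R)
  (n0 : nat) (p q M : nat -> nat) (nu : nat -> nat -> nat)
  (X : forall n : nat, 'M[R]_(n, p n)) (beta : forall n : nat, 'cV[R]_(p n))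
  (Om : forall n : nat, 'M[R]_n) (eps : forall n : nat, T n -> 'cV[R]_n)
  (wstar wtil : forall n : nat, 'rV[R]_(M n)) :
  let mu := fun n : nat => X n *m beta n in
  let Pm := fun (n : nat) (m : nat) => projmat (X n) (nu n m) in
  let Rn := fun (n : nat) (A : 'M[R]_n) => risk (P n) (eps n) (mu n) A in
  let th := fun n m : nat => theta (Pm n) (mu n) (Om n) m in
  let d_ := fun n : nat => dn (q n) (Pm n) (mu n) (Om n) in
  (* standing setting, for every sample size n >= n0 *)
  (forall n, (n0 <= n)%N ->
     [/\ (p n < n)%N, nu n 0%N = 0%N,
         (forall m, (m < q n)%N -> (nu n m < nu n m.+1)%N) & nu n (q n) = p n]) ->
  (forall n m, (n0 <= n)%N -> (1 <= m <= q n)%N ->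
     \rank (firstcols (X n) (nu n m)) = nu n m) ->
  (forall n, (n0 <= n)%N -> (2 <= M n <= q n)%N) ->
  (forall n, (n0 <= n)%N -> posdef (Om n)) ->
  (forall n i, (n0 <= n)%N -> measurable_fun setT (fun t => eps n t i ord0)) ->
  (forall n i, (n0 <= n)%N ->
     (P n).-integrable setT (fun t => ((eps n t i ord0) ^+ 2)%:E)) ->
  (forall n i, (n0 <= n)%N -> ('E_(P n)[fun t => eps n t i ord0] = 0%:E)%E) ->
  (forall n i j, (n0 <= n)%N ->
     ('E_(P n)[fun t => (eps n t i ord0 * eps n t j ord0)%R] = (Om n i j)%:E)%E) ->
  (forall n, (n0 <= n)%N -> inW (wstar n) /\
     forall w : 'rV[R]_(M n), inW w ->
       Rn n (avgmat (Pm n) (wstar n)) <= Rn n (avgmat (Pm n) w)) ->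
  (forall n, (n0 <= n)%N -> inQ (wtil n) /\
     forall w : 'rV[R]_(M n), inQ w ->
       Rn n (avgmat (Pm n) (wtil n)) <= Rn n (avgmat (Pm n) w)) ->
  (* Assumption 1 *)
  (exists (C : R) (N : nat), forall n, (N <= n)%N -> sqnorm (mu n) / n%:R <= C) ->
  (* Assumption 2 *)
  (exists c1 c2 : R, [/\ 0 < c1, c1 <= c2 &
     forall n a, (n0 <= n)%N -> eigenvalue (Om n) a -> c1 < a < c2]) ->
  (* Assumption 3 *)
  (exists N : nat, forall n m, (N <= n)%N -> (1 <= m)%N -> (m < q n)%N ->
     th n m.+1 <= th n m) ->
  (* Assumption 4 *)
  (exists (V : R) (N : nat), 1 <= V /\ forall n m, (N <= n)%N -> (1 <= m <= d_ n)%N ->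
     (nu n m - nu n m.-1)%:R <= V) ->
  (* Assumption 5 *)
  (forall m : nat, (1 <= m)%N -> exists (thb : R) (K : nat), 0 < thb /\
     forall n, (K <= n)%N -> (m <= d_ n)%N /\ thb <= th n m) ->
  (* Assumption 6 *)
  (exists N : nat, forall n, (N <= n)%N -> exists m' : nat,
     [/\ (1 <= m')%N, (m' <= (d_ n).-1)%N,
         (forall m, (2 <= m <= m')%N -> Rn n (Pm n m) < Rn n (Pm n m.-1)),
         (forall m, (m' < m <= d_ n)%N -> Rn n (Pm n m.-1) <= Rn n (Pm n m)) &
         Rn n (Pm n (d_ n).-1) < Rn n (Pm n (d_ n))]) ->
  (* conclusion: R_n(w_star) - R_n(w_tilde) = o(R_n(w_star)) *)
  forall e : R, 0 < e -> exists N : nat, forall n, (N <= n)%N ->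
    `| Rn n (avgmat (Pm n) (wstar n)) - Rn n (avgmat (Pm n) (wtil n)) |
      <= e * Rn n (avgmat (Pm n) (wstar n)).
Proof.
move=> mu Pm Rn th d_ design full_rank sizeM posOm meps ieps Eeps Ceps ws_opt wt_opt.
move=> _ _ [N3 th_dec] _ /(_ 1%N isT) [thb [K [thb0 th1]]] _ e e0.
(* Beyond this threshold [n * thb] is at least [e^-1], which makes the relative loss at most [e]. *)
have [N1 N1e] : exists N : nat, (e * thb)^-1 <= N%:R.
  by exists (Num.bound (e * thb)^-1); rewrite ltW// archi_boundP// invr_ge0 ltW// mulr_gt0.
exists (maxn (maxn n0 N3) (maxn K N1)) => n.
rewrite !geq_max => /andP[/andP[nn0 nN3] /andP[nK nN1]].
have [pn nu0 nu_incr nuq] := design n nn0.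
have [M2 Mq] := andP (sizeM n nn0).
have n_gt0 : (0 < n)%N by exact: leq_ltn_trans pn.
have Pm0 : Pm n 0%N = 0 by rewrite /Pm nu0 projmat0.
have trP k : (Pm n k)^T = Pm n k by exact: tr_projmat.
have rankX k : (k <= q n)%N -> \rank (firstcols (X n) (nu n k)) = nu n k.
  case: k => [|k] kq; last exact: full_rank.
  (* The rank hypothesis starts at model 1; at index 0 the matrix has no columns. *)
  by move: (rank_leq_col (firstcols (X n) (nu n 0))); rewrite nu0 leqn0 => /eqP.
have nu_le : {in [pred k | (k <= q n)%N] &, {homo nu n : k l / (k <= l)%N}}.
  apply: homo_leq_in => //.
  - by move=> x y z; exact: leq_trans.
  - by move=> k l _ lq m /andP[_ /ltnW ml]; exact: leq_trans lq.
  - by move=> k _ kq; exact: ltnW (nu_incr _ kq).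
have mulP k l : (k <= q n)%N -> (l <= q n)%N ->
    Pm n k *m Pm n l = Pm n (minn k l).
  move=> kq lq; rewrite /Pm projmatM ?rankX//; congr projmat.
  have [kl|/ltnW lk] := leqP k l.
    by apply/minn_idPl; exact: nu_le.
  by apply/minn_idPr; exact: nu_le.
have RnE A : Rn n A = sqnorm (A *m mu n - mu n) + \tr (A *m Om n *m A^T).
  by apply: riskE => *; [exact: meps|exact: ieps|exact: Eeps|exact: Ceps].
have [wsW ws_min] := ws_opt n nn0.
have [wtQ wt_min] := wt_opt n nn0.
have [|v0 v0_le gap] := simplex_risk_gap trP mulP Pm0 Mq (posOm n nn0) (wtil n)
  n_gt0 (ltnW M2) (fun m => th_dec n m nN3) wsW.
  by move=> w wW; rewrite -!RnE; exact: ws_min.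
rewrite -!RnE in v0_le gap.
(* The simplex lies in the box, so the difference of the minimal risks is nonnegative. *)
rewrite ger0_norm ?subr_ge0; last by apply: wt_min; case: wsW.
apply: le_trans gap (le_trans _ (ler_wpM2l (ltW e0) v0_le)).
have [_ th1n] := th1 n nK.
have nth : e^-1 <= n%:R * theta (Pm n) (mu n) (Om n) 1.
  apply: le_trans (_ : n%:R * thb <= _); last by rewrite ler_wpM2l.
  rewrite -ler_pdivrMr// -invfM (le_trans N1e)// ler_nat//.
have e1 : 0 < e^-1 by rewrite invr_gt0.
rewrite [leRHS]mulrC ler_wpM2l// -[leRHS]invrK lef_pV2 ?posrE//; lra.
Qed.
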